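(* For every real number $p>0$, the set $L_{p}[0,1] \setminus \bigcup_{q>p} L_{q}[0,1]$ is spaceable in $L_p[0,1]$; that is, there exists an infinite dimensional closed linear subspace $Y$ of $L_p[0,1]$ such that $Y \subset \left(L_{p}[0,1] \setminus \bigcup_{q>p} L_{q}[0,1]\right) \cup \{0\}$.
   Context: For a real number $p>0$, $L_p[0,1]$ denotes the space of (almost everywhere equivalence classes of) Lebesgue measurable functions $f\colon [0,1]\to\mathbb{R}$ with $\int_0^1 |f(x)|^p\,dx<\infty$, with the topology given by $\|f\|_{L_p}=\left(\int_0^1|f(x)|^p\,dx\right)^{1/p}$, which is a norm (Banach space) for $p\ge 1$ and a quasi-norm (quasi-Banach space) for $0<p<1$. The union $\bigcup_{q>p}$ is over all real $q>p$. A subset $M$ of a topological vector space $X$ is called spaceable if there exists an infinite dimensional closed linear subspace $Y$ of $X$ with $Y\subset M\cup\{0\}$. *)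

(* Defs.v *)
From HB Require Import structures.
From mathcomp Require Import all_boot all_order all_algebra.
From mathcomp Require Import all_classical all_reals all_analysis.
From mathcomp Require Import measurable_realfun.

Set Implicit Arguments.
Unset Strict Implicit.
Unset Printing Implicit Defensive.

Import Order.TTheory GRing.Theory Num.Theory.
Import numFieldTopology.Exports numFieldNormedType.Exports.

Local Open Scope classical_set_scope.
Local Open Scope ring_scope.

Section spaceability.
Context (K : numFieldType) (X : topologicalLmodType K).

(* Meant for linear subspaces Y. *)
Definition finite_dimensional (Y : set X) : Prop :=
  exists (n : nat) (e : 'I_n -> X), (forall i, Y (e i)) /\
    forall y, Y y -> exists c : 'I_n -> K, y = \sum_(i < n) c i *: e i.

Definition spaceable (M : set X) : Prop :=
  exists Y : set X, [/\ submod_closed [in Y], ~ finite_dimensional Y,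
    closed Y & Y `<=` M `|` [set 0]].

End spaceability.

Section measurable_functions_modulo_ae.
Context d (T : measurableType d) (R : realType) (mu : {measure set T -> \bar R}).
Local Open Scope quotient_scope.

(* Real measurable functions modulo mu-a.e. equality, with the vector space
   structure induced by the pointwise operations. *)
Definition L0 : Type := {mfun_ mu, T >-> R}.
HB.instance Definition _ := Choice.on L0.
HB.instance Definition _ := EqQuotient.on L0.

Definition L0_fun (f : L0) : {mfun T >-> R} := repr f.
Coercion L0_fun : L0 >-> MeasurableFun.type.

Lemma L0_piP (f g : {mfun T >-> R}) :
  \pi_L0 f = \pi_L0 g <-> f = g %[ae mu].
Proof.
split=> [/eqP|fg]; first by rewrite eqmodE => /asboolP.
by apply/eqP; rewrite eqmodE; exact/asboolP.
Qed.

Lemma L0_reprP (f : {mfun T >-> R}) : (\pi_L0 f : L0) = f %[ae mu].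
Proof. by apply/L0_piP; rewrite /L0_fun reprK. Qed.

Lemma L0_eqP (f g : L0) : f = g <-> (f : T -> R) = g %[ae mu].
Proof. by rewrite -L0_piP /L0_fun !reprK. Qed.

Definition L0_zero : L0 := \pi_L0 (0 : {mfun T >-> R}).
Definition L0_opp (f : L0) : L0 := \pi_L0 (- (f : {mfun T >-> R})).
Definition L0_add (f g : L0) : L0 := \pi_L0 ((f : {mfun T >-> R}) + g).
Definition L0_scale (a : R) (f : L0) : L0 := \pi_L0 (a *: (f : {mfun T >-> R})).

Lemma L0_oppP (f : {mfun T >-> R}) : L0_opp (\pi_L0 f) = \pi_L0 (- f).
Proof.
apply/L0_piP; move: (L0_reprP f); apply: filterS => x + _ => /(_ I) /= fx.
exact: (congr1 -%R fx).
Qed.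

Lemma L0_addP (f g : {mfun T >-> R}) :
  L0_add (\pi_L0 f) (\pi_L0 g) = \pi_L0 (f + g).
Proof.
apply/L0_piP; move: (L0_reprP f) (L0_reprP g).
apply: filterS2 => x + + _ => /(_ I) /= fx /(_ I) /= gx.
exact: (congr2 +%R fx gx).
Qed.

Lemma L0_scaleP a (f : {mfun T >-> R}) :
  L0_scale a (\pi_L0 f) = \pi_L0 (a *: f).
Proof.
apply/L0_piP; move: (L0_reprP f); apply: filterS => x + _ => /(_ I) /= fx.
exact: (congr1 ( *%R a) fx).
Qed.

Lemma L0_ind (P : L0 -> Prop) :
  (forall f : {mfun T >-> R}, P (\pi_L0 f)) -> forall f, P f.
Proof. by move=> Ppi f; rewrite -[f]reprK; exact: Ppi. Qed.

Lemma L0_addA : associative L0_add.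
Proof.
move=> f g h.
elim/L0_ind: f => f; elim/L0_ind: g => g; elim/L0_ind: h => h.
by rewrite !L0_addP addrA.
Qed.

Lemma L0_addC : commutative L0_add.
Proof.
by move=> f g; elim/L0_ind: f => f; elim/L0_ind: g => g; rewrite !L0_addP addrC.
Qed.

Lemma L0_add0 : left_id L0_zero L0_add.
Proof. by move=> f; elim/L0_ind: f => f; rewrite L0_addP add0r. Qed.

Lemma L0_addN : left_inverse L0_zero L0_opp L0_add.
Proof. by move=> f; elim/L0_ind: f => f; rewrite L0_oppP L0_addP addNr. Qed.

HB.instance Definition _ :=
  GRing.isZmodule.Build L0 L0_addA L0_addC L0_add0 L0_addN.

Lemma L0_scaleA a b f : L0_scale a (L0_scale b f) = L0_scale (a * b) f.
Proof. by elim/L0_ind: f => f; rewrite !L0_scaleP scalerA. Qed.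

Lemma L0_scale1 : left_id 1 L0_scale.
Proof. by move=> f; elim/L0_ind: f => f; rewrite L0_scaleP scale1r. Qed.

Lemma L0_scaleDr : right_distributive L0_scale +%R.
Proof.
move=> a f g; elim/L0_ind: f => f; elim/L0_ind: g => g.
by rewrite [X in L0_scale _ X]L0_addP !L0_scaleP scalerDr [RHS]L0_addP.
Qed.

Lemma L0_scaleDl f : {morph L0_scale^~ f : a b / a + b >-> a + b}.
Proof.
move=> a b; elim/L0_ind: f => f.
by rewrite !L0_scaleP scalerDl [RHS]L0_addP.
Qed.

HB.instance Definition _ := GRing.Zmodule_isLmodule.Build R L0
  L0_scaleA L0_scale1 L0_scaleDr L0_scaleDl.

Lemma L0_0E : (0 : L0) = (0 : T -> R) %[ae mu].
Proof. exact: L0_reprP. Qed.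

Lemma L0_NE (f : L0) : (- f : L0) = (fun x => - f x) %[ae mu].
Proof. exact: L0_reprP. Qed.

Lemma L0_DE (f g : L0) : (f + g : L0) = (fun x => f x + g x) %[ae mu].
Proof. exact: L0_reprP. Qed.

Lemma L0_ZE a (f : L0) : (a *: f : L0) = (fun x => a * f x) %[ae mu].
Proof. exact: L0_reprP. Qed.

End measurable_functions_modulo_ae.

Section Lp_spaces.
Context d (T : measurableType d) (R : realType) (mu : {measure set T -> \bar R}).
Implicit Types (p q : R) (f g h : L0 mu).

(* Lfun mu p%:E only asks for measurability and a finite 'N[mu]_p, for every
   real p; the representative of the class f is always measurable, and its norm
   does not depend on the choice of representative (eq_LpModular). *)
Definition Lp p : set (L0 mu) := [set f | (f : T -> R) \in Lfun mu p%:E].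

(* The (quasi-)norm; extended-real valued because f ranges over all of L0. *)
Definition LpNorm p f : \bar R := 'N[mu]_p%:E [EFin \o f]%E.

Definition LpModular p f : \bar R := (\int[mu]_x (`|f x| `^ p)%:E)%E.

Lemma measurable_modular p (f : {mfun T >-> R}) :
  measurable_fun setT (fun x => (`|f x| `^ p)%:E : \bar R).
Proof.
apply/measurable_EFinP; apply: (measurableT_comp (measurable_powR p)).
by apply: measurableT_comp => //; exact: measurable_funPT.
Qed.

Lemma LpModular_ge0 p f : (0 <= LpModular p f)%E.
Proof. by apply: integral_ge0 => x _; rewrite lee_fin powR_ge0. Qed.

Lemma LpNormE p f : LpNorm p f = (LpModular p f `^ p^-1)%E.
Proof. by rewrite /LpNorm unlock. Qed.

Lemma LpNorm_ge0 p f : (0 <= LpNorm p f)%E.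
Proof. by rewrite LpNormE poweR_ge0. Qed.

Lemma eq_LpModular p f (g : {mfun T >-> R}) : (f : T -> R) = g %[ae mu] ->
  LpModular p f = (\int[mu]_x (`|g x| `^ p)%:E)%E.
Proof.
move=> fg; apply: ae_eq_integral => //; do ?exact: measurable_modular.
by move: fg; apply: filterS => x /= + _ => /(_ I) ->.
Qed.

Lemma LpModularD p f g : 0 <= p ->
  (LpModular p (f + g)%R <= (2 `^ p)%:E * (LpModular p f + LpModular p g))%E.
Proof.
move=> p0.
rewrite (@eq_LpModular p (f + g) ((f : {mfun T >-> R}) + g)); last exact: L0_DE.
rewrite /LpModular -ge0_integralD//; do ?exact: measurable_modular.
rewrite -ge0_integralZl_EFin//=; first last.
- by apply: emeasurable_funD; exact: measurable_modular.
- by move=> x _; rewrite adde_ge0 ?lee_fin ?powR_ge0.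
apply: ge0_le_integral => //.
- exact: (measurable_modular p ((f : {mfun T >-> R}) + g)).
- apply: emeasurable_funM => //.
  by apply: emeasurable_funD; exact: measurable_modular.
move=> x _; rewrite -EFinD -EFinM lee_fin.
wlog fg : f g / `|f x| <= `|g x|.
  move=> wlg; have [|/ltW gf] := leP `|f x| `|g x|; first exact: wlg.
  by move: (wlg _ _ gf); rewrite [X in X -> _]/= addrC [X in _ * X]addrC.
apply: (@le_trans _ _ ((2 * `|g x|) `^ p)).
  rewrite ge0_ler_powR ?nnegrE ?mulr_ge0// (le_trans (ler_normD _ _))//.
  by rewrite mulrDl !mul1r lerD.
by rewrite powRM// ler_wpM2l ?powR_ge0// lerDr powR_ge0.
Qed.

Lemma LpNormZ p (a : R) f : 0 < p ->
  LpNorm p (a *: f) = (`|a|%:E * LpNorm p f)%E.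
Proof.
move=> p0; rewrite !LpNormE.
rewrite (@eq_LpModular p (a *: f) (a *: (f : {mfun T >-> R}))); last first.
  exact: L0_ZE.
rewrite (@eq_integral _ _ _ _ _ (fun x => (`|a| `^ p)%:E * (`|f x| `^ p)%:E)%E);
  last by move=> x _; rewrite -EFinM -powRM// -normrM.
rewrite ge0_integralZl_EFin//; last exact: measurable_modular.
rewrite poweRM ?lee_fin ?powR_ge0 ?LpModular_ge0//.
by rewrite poweR_EFin -powRrM divff ?gt_eqF// powRr1.
Qed.

Lemma LpNorm_lt p (e : R) f : 0 < p -> 0 < e ->
  (LpNorm p f < e%:E)%E = (LpModular p f < (e `^ p)%:E)%E.
Proof.
move=> p0 e0; have NE : (LpNorm p f `^ p)%E = LpModular p f.
  by rewrite /LpNorm poweR_Lnorm ?gt_eqF.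
rewrite -NE; move: (LpNorm_ge0 p f).
case: (LpNorm p f) => [r r0| _|//]; last first.
  by rewrite poweRyr ?gt_eqF// !ltye_eq.
rewrite poweR_EFin !lte_fin; apply/idP/idP => [re|].
  by rewrite gt0_ltr_powR ?nnegrE// ltW.
by apply: contraTT; rewrite -!leNgt => er; rewrite ge0_ler_powR ?nnegrE// ltW.
Qed.

Definition quasi_const p : R := (2 `^ p * 2) `^ p^-1.

Lemma quasi_const_gt0 p : 0 < quasi_const p.
Proof. by rewrite powR_gt0// mulr_gt0// powR_gt0. Qed.

Lemma LpNormD_lt p (e : R) f g : 0 < p -> 0 < e ->
  (LpNorm p f < e%:E)%E -> (LpNorm p g < e%:E)%E ->
  (LpNorm p (f + g)%R < (quasi_const p * e)%:E)%E.
Proof.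
move=> p0 e0; have c0 := quasi_const_gt0 p.
rewrite !LpNorm_lt ?mulr_gt0// => Nf Ng.
apply: (le_lt_trans (LpModularD _ _ (ltW p0))).
rewrite powRM ?(ltW c0) ?(ltW e0)// /quasi_const -powRrM mulVf ?gt_eqF//.
rewrite powRr1 ?mulr_ge0 ?powR_ge0// -mulrA EFinM lte_pmul2l ?lte_fin ?powR_gt0//.
have -> : 2 * e `^ p = e `^ p + e `^ p by rewrite mulrDl mul1r.
by apply: (lt_le_trans (lteD Nf Ng)); rewrite -EFinD.
Qed.

Lemma LpP p f : Lp p f <-> (LpNorm p f < +oo)%E.
Proof.
rewrite /Lp /= /LpNorm; split=> [/andP[_]|Nf]; first by rewrite inE.
by apply/andP; split; rewrite inE//=; exact: measurable_funPT.
Qed.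

Variables (p : R) (p0 : 0 < p).

Lemma LpNorm0 : LpNorm p 0 = 0%E.
Proof. by rewrite -(scale0r 0) LpNormZ// normr0 mul0e. Qed.

Lemma Lp_submod_closed : submod_closed [in Lp p].
Proof.
split=> [|a f g].
  by rewrite inE; apply/LpP; rewrite LpNorm0.
rewrite !inE => /LpP Nf /LpP Ng; apply/LpP.
have Naf : (LpNorm p (a *: f)%R < +oo)%E.
  by rewrite LpNormZ// lte_mul_pinfty// lee_fin.
pose r := fine (LpNorm p (a *: f)) + fine (LpNorm p g) + 1.
have [F0 G0] : 0 <= fine (LpNorm p (a *: f)) /\ 0 <= fine (LpNorm p g).
  by split; rewrite fine_ge0// LpNorm_ge0.
have r0 : 0 < r by rewrite ltr_wpDl// addr_ge0.
apply: (lt_trans (LpNormD_lt p0 r0 _ _) (ltry _)).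
  rewrite -[X in (X < _)%E]fineK ?ge0_fin_numE ?LpNorm_ge0// lte_fin.
  by rewrite /r -addrA ltrDl ltr_wpDl.
rewrite -[X in (X < _)%E]fineK ?ge0_fin_numE ?LpNorm_ge0// lte_fin.
by rewrite /r addrAC ltrDr ltr_wpDl.
Qed.

(* Lp p as a boolean predicate, carrying the proof of 0 < p because Lp p is only
   a linear subspace of L0 in that case. *)
Definition LpPred of 0 < p : {pred L0 mu} := [in Lp p].

HB.instance Definition _ :=
  GRing.isSubmodClosed.Build R (L0 mu) (LpPred p0) Lp_submod_closed.

(* The space L_p as a topological vector space, for every p > 0 (the library
   spaces LfunType and LspaceType require p >= 1). Its topology is the one of
   the (quasi-)norm: a neighbourhood of u is a set containing some ball
   [set v | LpNorm p (v - u) < e], e > 0. *)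
Definition LpType : Type := {f : L0 mu | f \in LpPred p0}.
HB.instance Definition _ := SubChoice.on LpType.
HB.instance Definition _ := [SubChoice_isSubLmodule of LpType by <:].

Implicit Types u v w : LpType.

Definition Lp_class u : L0 mu := \val u.

Lemma Lp_class0 : Lp_class 0 = 0. Proof. by []. Qed.
Lemma Lp_classD u v : Lp_class (u + v) = Lp_class u + Lp_class v.
Proof. by []. Qed.
Lemma Lp_classZ (a : R) u : Lp_class (a *: u) = a *: Lp_class u.
Proof. by []. Qed.

Definition Lp_ball u (e : R) : set LpType :=
  [set v | (LpNorm p (Lp_class (v - u)%R) < e%:E)%E].

Definition Lp_nbhs u : set_system LpType :=
  filter_from [set e : R | 0 < e] (Lp_ball u).

HB.instance Definition _ := hasNbhs.Build LpType Lp_nbhs.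

Lemma Lp_ball_center u e : 0 < e -> Lp_ball u e u.
Proof.
by move=> e0; rewrite /Lp_ball /mkset subrr Lp_class0 LpNorm0.
Qed.

Lemma Lp_ball_triangle u v w e : 0 < e ->
  Lp_ball u e v -> Lp_ball v e w -> Lp_ball u (quasi_const p * e) w.
Proof.
move=> e0 uv vw; rewrite /Lp_ball /mkset -(subrKA v) Lp_classD.
exact: LpNormD_lt.
Qed.

Lemma Lp_nbhs_filter u : ProperFilter (nbhs u).
Proof.
apply: filter_from_proper; last by move=> e e0; exists u; exact: Lp_ball_center.
apply: filter_from_filter; first by exists 1 => /=.
move=> e1 e2 /= e10 e20; exists (Num.min e1 e2); first by rewrite /= lt_min e10.
by move=> v; split; apply: (lt_le_trans H); rewrite lee_fin ge_min lexx ?orbT.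
Qed.

Lemma Lp_nbhs_singleton u (A : set LpType) : nbhs u A -> A u.
Proof. by move=> [e /= e0]; apply; exact: Lp_ball_center. Qed.

Lemma Lp_nbhs_nbhs u (A : set LpType) : nbhs u A -> nbhs u (nbhs^~ A).
Proof.
have c0 := quasi_const_gt0 p.
move=> [e /= e0 eA]; exists (e / quasi_const p); first by rewrite /= divr_gt0.
move=> v uv; exists (e / quasi_const p); first by rewrite /= divr_gt0.
move=> w vw; apply: eA; rewrite -(mulfVK (lt0r_neq0 c0) e) mulrC.
by apply: Lp_ball_triangle vw => //; rewrite divr_gt0.
Qed.

HB.instance Definition _ := Nbhs_isNbhsTopological.Build LpType
  Lp_nbhs_filter Lp_nbhs_singleton Lp_nbhs_nbhs.

Lemma Lp_sub_continuous :
  continuous (fun x : LpType * LpType => x.1 - x.2).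
Proof.
have c0 := quasi_const_gt0 p.
move=> [u v] /= A [e /= e0 eA].
have ec0 : 0 < e / quasi_const p by rewrite divr_gt0.
exists (Lp_ball u (e / quasi_const p), Lp_ball v (e / quasi_const p)) => /=.
  by split; exists (e / quasi_const p).
move=> [u' v'] /= [uu' vv']; apply: eA.
rewrite -(mulfVK (lt0r_neq0 c0) e) mulrC /Lp_ball /mkset.
rewrite (_ : u' - v' - (u - v) = (u' - u) + (-1) *: (v' - v)); last first.
  by rewrite scaleN1r !opprB addrACA [RHS]addrACA; congr (_ + _); rewrite addrC.
rewrite Lp_classD; apply: LpNormD_lt => //.
by rewrite Lp_classZ LpNormZ// normrN1 mul1e.
Qed.

HB.instance Definition _ :=
  PreTopologicalNmodule_isTopologicalZmodule.Build LpType
    Lp_sub_continuous.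

Lemma Lp_scale_continuous :
  continuous (fun z : R^o * LpType => z.1 *: z.2).
Proof.
have c0 := quasi_const_gt0 p.
move=> [a u] /= A [e /= e0 eA].
pose e' := e / quasi_const p.
have e'0 : 0 < e' by rewrite divr_gt0.
pose N := fine (LpNorm p (Lp_class u)).
have N0 : 0 <= N by rewrite fine_ge0// LpNorm_ge0.
have NE : LpNorm p (Lp_class u) = N%:E.
  rewrite fineK// ge0_fin_numE ?LpNorm_ge0//.
  by apply/LpP; have := valP u; rewrite inE.
pose r := Num.min 1 (e' / (N + 1)).
have r0 : 0 < r by rewrite lt_min ltr01 divr_gt0// ltr_wpDl.
have a0 : 0 < `|a| + 1 by rewrite ltr_wpDl.
exists (ball a r, Lp_ball u (e' / (`|a| + 1))) => /=.
  split; first exact: nbhsx_ballx.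
  by exists (e' / (`|a| + 1)) => //=; rewrite divr_gt0.
move=> [b v] /= [ab uv]; apply: eA.
rewrite -(mulfVK (lt0r_neq0 c0) e) mulrC /Lp_ball /mkset.
rewrite (_ : b *: v - a *: u = b *: (v - u) + (b - a) *: u); last first.
  by rewrite scalerBr scalerBl addrA subrK.
move: ab; rewrite /ball /= lt_min distrC => /andP[ab1 abN].
rewrite Lp_classD; apply: LpNormD_lt => //; rewrite Lp_classZ LpNormZ//.
  have ba : `|b| < `|a| + 1.
    by rewrite -(subrK a b) (le_lt_trans (ler_normD _ _))// addrC ltrD2l.
  rewrite -/e' -(mulfVK (lt0r_neq0 a0) e') mulrC EFinM.
  apply: (@le_lt_trans _ _ ((`|a| + 1)%:E * LpNorm p (Lp_class (v - u)%R))%E).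
    by rewrite lee_wpmul2r ?LpNorm_ge0// lee_fin ltW.
  by rewrite lte_pmul2l// mulrC.
rewrite NE -EFinM lte_fin -/e'.
have N10 : 0 < N + 1 by rewrite ltr_wpDl.
rewrite -(mulfVK (lt0r_neq0 N10) e').
apply: (@le_lt_trans _ _ (`|b - a| * (N + 1))).
  by rewrite ler_wpM2l// lerDl.
by rewrite ltr_pM2r.
Qed.

HB.instance Definition _ :=
  TopologicalNmodule_isTopologicalLmodule.Build R LpType
    Lp_scale_continuous.

End Lp_spaces.
Arguments Lp {d T R} mu p _ : rename.

Section Lebesgue_unit_interval.
Context {R : realType}.

Let measurable01 : measurable (`[0%R, 1%R] : set
  (caratheodory_type (wlength (@idfun R))^*%mu)).
Proof. by apply: sub_caratheodory; exact: measurable_itv. Qed.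

(* Lebesgue measure on the full (completed) Lebesgue sigma-algebra of R,
   concentrated on [0, 1]: a class modulo lebesgue01-a.e. equality only depends
   on the values on [0, 1], and integrals against lebesgue01 are integrals over
   [0, 1], so L0 lebesgue01 and LpType lebesgue01 p0 are L_0[0, 1] and
   L_p[0, 1]. *)
Definition lebesgue01 := mrestr (@completed_lebesgue_measure R) measurable01.
HB.instance Definition _ := Measure.on lebesgue01.

End Lebesgue_unit_interval.

(* Main.v *)
Require Import Defs.
From HB Require Import structures.
From mathcomp Require Import all_boot all_order all_algebra.
From mathcomp Require Import all_classical all_reals all_analysis.
From mathcomp Require Import measurable_realfun.

Import Order.TTheory GRing.Theory Num.Theory.
Import numFieldTopology.Exports numFieldNormedType.Exports.

Local Open Scope classical_set_scope.
Local Open Scope ring_scope.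

(* Let G be a step function taking the value v_j on disjoint sets F_j (j > 0)
   with mu F_j <= 2^(-j^2), where v_j^p mu F_j = 2^-j.  Then G is in L_p, but for
   q > p the numbers v_j^q mu F_j tend to infinity, so G is not in L_q on any
   union of infinitely many F_j.  Partition the indices j into infinitely many
   infinite classes according to the 2-adic valuation of j, with a corresponding
   partition (E_n) of the space.  The functions which are on each E_n a multiple
   c_n G of G form the required subspace: it is closed because a line in L_p is
   closed and restriction to E_n is a contraction, and a nonzero element has some
   c_n != 0, hence is outside every L_q. *)

Set Implicit Arguments.
Unset Strict Implicit.
Unset Printing Implicit Defensive.

(** * Multiplication of classes by measurable functions *)

Section multiplication.
Context d (T : measurableType d) (R : realType) (mu : {measure set T -> \bar R}).
Implicit Types (f g : L0 mu) (h : {mfun T >-> R}) (p : R).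
Local Open Scope quotient_scope.

Definition L0_mul h f : L0 mu := \pi_(L0 mu) (h * (f : {mfun T >-> R})).

Lemma L0_mulE h f : (L0_mul h f : T -> R) = (fun x => h x * f x) %[ae mu].
Proof. exact: L0_reprP. Qed.

Lemma L0_mul_pi h (f : {mfun T >-> R}) :
  L0_mul h (\pi_(L0 mu) f) = \pi_(L0 mu) (h * f).
Proof.
apply/L0_piP; move: (L0_reprP mu f); apply: filterS => x + _ => /(_ I) /= fx.
exact: (congr1 ( *%R (h x)) fx).
Qed.

Lemma L0_add_pi (f g : {mfun T >-> R}) :
  \pi_(L0 mu) f + \pi_(L0 mu) g = \pi_(L0 mu) (f + g).
Proof. exact: L0_addP. Qed.

Lemma L0_scale_pi a (f : {mfun T >-> R}) :
  a *: \pi_(L0 mu) f = \pi_(L0 mu) (a *: f).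
Proof. exact: L0_scaleP. Qed.

Lemma L0_mul_is_linear h : linear (L0_mul h).
Proof.
move=> a f g; elim/L0_ind: f => f; elim/L0_ind: g => g.
rewrite (L0_mul_pi h f) (L0_mul_pi h g) !L0_scale_pi !L0_add_pi L0_mul_pi.
by congr (\pi_(L0 mu) _); apply/mfuneqP => x /=; rewrite mulrDr mulrCA.
Qed.

HB.instance Definition _ h :=
  GRing.isLinear.Build R (L0 mu) (L0 mu) *:%R (L0_mul h) (L0_mul_is_linear h).

Lemma L0_mulA h1 h2 f : L0_mul h1 (L0_mul h2 f) = L0_mul (h1 * h2) f.
Proof. by elim/L0_ind: f => f; rewrite !L0_mul_pi mulrA. Qed.

Lemma L0_mul0l f : L0_mul 0 f = 0.
Proof. by rewrite /L0_mul mul0r. Qed.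

(** Pointwise domination of the modular integrands. With [h] an indicator, this makes restriction to
    a measurable set continuous on L_p. *)
Lemma LpNorm_mul_le h p f : 0 < p -> (forall x, `|h x| <= 1) ->
  (LpNorm p (L0_mul h f) <= LpNorm p f)%E.
Proof.
move=> p0 h1; rewrite !LpNormE.
apply: gt0_ler_poweR;
  rewrite ?invr_ge0 ?(ltW p0) ?in_itv/= ?leey ?LpModular_ge0//.
rewrite (eq_LpModular p (L0_mulE h f : _ = (h * (f : {mfun T >-> R})) %[ae mu])).
rewrite /LpModular; apply: ge0_le_integral => //.
- exact: (measurable_modular p (h * (f : {mfun T >-> R}))).
- exact: measurable_modular.
move=> x _; rewrite lee_fin ge0_ler_powR ?nnegrE// ?(ltW p0)//=.
by rewrite normrM ler_piMl.
Qed.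

End multiplication.

(** * Quasi-norm estimates and closedness of lines *)

Section Lp_norm.
Context d (T : measurableType d) (R : realType) (mu : {measure set T -> \bar R}).
Implicit Types (f g : L0 mu) (p : R).

Lemma LpNorm_eq0 p f : 0 < p -> LpNorm p f = 0%E -> f = 0.
Proof.
move=> p0; rewrite LpNormE => /poweR_eq0_eq0 => /(_ (LpModular_ge0 _ _)) f0.
have mp := measurable_modular p (f : {mfun T >-> R}).
apply/L0_eqP; have /(ae_eq_integral_abs mu measurableT mp) :
    (\int[mu]_x `|(`|f x| `^ p)%:E|)%E = 0%E.
  rewrite -[RHS]f0; apply: eq_integral => x _.
  by rewrite gee0_abs// lee_fin powR_ge0.
have := L0_0E mu; apply: filterS2 => x /= + + _ => /(_ I) -> /(_ I) [] /eqP.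
by rewrite powR_eq0 normr_eq0 => /andP[/eqP].
Qed.

Lemma LpP_modular p f : 0 < p -> Lp mu p f <-> (LpModular p f < +oo)%E.
Proof.
move=> p0; rewrite LpP LpNormE; split; last exact: poweR_lty.
by apply: lty_poweRy; rewrite invr_eq0 gt_eqF.
Qed.

Lemma Lp_mul (h : {mfun T >-> R}) p f : 0 < p -> (forall x, `|h x| <= 1) ->
  Lp mu p f -> Lp mu p (L0_mul h f).
Proof. by move=> p0 h1 /LpP fp; apply/LpP/(le_lt_trans _ fp)/LpNorm_mul_le. Qed.

Lemma LpZ p (a : R) f : 0 < p -> Lp mu p f -> Lp mu p (a *: f).
Proof.
move=> p0 /LpP fp; apply/LpP; rewrite LpNormZ//.
by rewrite lte_mul_pinfty ?lee_fin.
Qed.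

Lemma LpNormB_lt p (e : R) f g : 0 < p -> 0 < e ->
  (LpNorm p f < e%:E)%E -> (LpNorm p g < e%:E)%E ->
  (LpNorm p (f - g)%R < (quasi_const p * e)%:E)%E.
Proof.
by move=> p0 e0 fe ge; apply: LpNormD_lt => //;
  rewrite -scaleN1r LpNormZ// normrN1 mul1e.
Qed.

Lemma LpNorm_small_eq0 p f : 0 < p ->
  (forall e : R, 0 < e -> (LpNorm p f < e%:E)%E) -> f = 0.
Proof.
move=> p0 fe; apply: (LpNorm_eq0 p0); apply/eqP.
rewrite eq_le LpNorm_ge0 andbT; apply/lee_addgt0Pr => e e0.
by rewrite add0e ltW// fe.
Qed.

(* A line of a quasi-normed space is complete, hence closed. *)
Lemma line_closed p f g : 0 < p -> (LpNorm p g < +oo)%E ->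
  (forall e : R, 0 < e -> exists c : R, (LpNorm p (f - c *: g)%R < e%:E)%E) ->
  exists c : R, f = c *: g.
Proof.
move=> p0 goo fg; have K0 := quasi_const_gt0 p.
have [g0|gN0] := eqVneq g 0.
  exists 0; rewrite scale0r; apply: (LpNorm_small_eq0 p0) => e /fg[c].
  by rewrite g0 scaler0 subr0.
pose r := fine (LpNorm p g).
have rE : LpNorm p g = r%:E by rewrite fineK// ge0_fin_numE ?LpNorm_ge0.
have r0 : 0 < r.
  rewrite lt_neqAle -[in X in _ && X]lee_fin -rE LpNorm_ge0 andbT eq_sym.
  by apply: contra_neq gN0 => r0; apply: (LpNorm_eq0 p0); rewrite rE r0.
have inv0 k : 0 < k.+1%:R^-1 :> R by rewrite invr_gt0.
have [c fc] := choice (fun k => fg _ (inv0 k)).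
have near_fc e : 0 < e ->
    \forall k \near \oo, (LpNorm p (f - c k *: g)%R < e%:E)%E.
  move=> e0; near=> k; apply: (lt_trans (fc k)); rewrite lte_fin.
  near: k; exact: near_infty_natSinv_lt (PosNum e0).
have /cvg_ex[/= l cl] : cvgn c.
  apply/cauchy_cvgP/cauchy_exP => e e0.
  (* If [c k *: g] and [c N *: g] are both this close to [f], the quasi-triangle inequality bounds
     [|c k - c N| * r] by [e * r], so [c] is Cauchy. *)
  have e'0 : 0 < e * r / quasi_const p by rewrite divr_gt0 ?mulr_gt0.
  have [N _ fN] := near_fc _ e'0.
  exists (c N); exists N => // k /= Nk; rewrite /ball/=.
  have := LpNormB_lt p0 e'0 (fN _ Nk) (fN _ (leqnn N)).
  rewrite opprB addrC subrKA -scalerBl LpNormZ// rE -EFinM lte_fin.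
  by rewrite mulrCA divff ?gt_eqF// mulr1 ltr_pM2r.
exists l; apply/eqP; rewrite -subr_eq0; apply/eqP/(LpNorm_small_eq0 p0) => e e0.
have e'0 : 0 < e / quasi_const p by rewrite divr_gt0.
(* One index [k] makes both [f - c k *: g] and [(c k - l) *: g] small; their sum is [f - l *: g]. *)
have [k fk ck] : exists2 k,
    (LpNorm p (f - c k *: g)%R < (e / quasi_const p)%:E)%E
    & `|l - c k| < e / quasi_const p / r.
  have cnear : \forall k \near \oo, `|l - c k| < e / quasi_const p / r.
    by apply: cvgr_dist_lt; rewrite ?divr_gt0.
  by have [k []] := filter_ex (filterI (near_fc _ e'0) cnear); exists k.
rewrite -(subrKA (c k *: g)) -scalerBl -(mulfVK (lt0r_neq0 K0) e) mulrC.
apply: LpNormD_lt => //.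
by rewrite LpNormZ// rE -EFinM lte_fin -ltr_pdivlMr// distrC.
Unshelve. all: by end_near.
Qed.
End Lp_norm.

(** Expanding m + 1 of the [v n] over m spanning vectors gives a matrix with more rows than columns;
    a nonzero vector of its left kernel is a forbidden linear relation. *)
Lemma independent_not_finite_dimensional (K : numFieldType)
    (X : topologicalLmodType K) (Y : set X) (v : nat -> X) :
  (forall n, Y (v n)) ->
  (forall m (a : 'I_m -> K), \sum_(i < m) a i *: v i = 0 -> forall i, a i = 0) ->
  ~ finite_dimensional Y.
Proof.
move=> Yv vfree [m [e [_ span]]].
have [c vE] := choice (fun n => span _ (Yv n)).
pose A := \matrix_(i < m.+1, j < m) c i j.
have : kermx A != 0.
  by rewrite kermx_eq0 /row_free ltn_eqF// ltnS rank_leq_col.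
case/rowV0Pn => u; rewrite sub_kermx => /eqP uA /eqP; apply.
apply/rowP => i; rewrite mxE; apply: (vfree _ (fun i => u 0 i)).
under eq_bigr do rewrite vE scaler_sumr.
rewrite exchange_big big1// => j _; under eq_bigr do rewrite scalerA.
rewrite -scaler_suml -[RHS](scale0r (e j)); congr (_ *: _).
transitivity ((u *m A) 0 j); last by rewrite uA mxE.
by rewrite mxE; apply: eq_bigr => k _; rewrite mxE.
Qed.

(** * The subspace attached to a partition *)

Section spaceability_from_a_partition.
Context d (T : measurableType d) (R : realType) (mu : {measure set T -> \bar R}).
Variables (p : R) (p0 : 0 < p) (E : nat -> set T).
Hypothesis (mE : forall n, measurable (E n)).
Hypotheses (tE : trivIset setT E) (coverE : \bigcup_n E n = setT).
Variable (g : L0 mu).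
Hypotheses (gp : Lp mu p g).
Local Notation chi n := (mindic R (mE n) : {mfun T >-> R}).
Local Notation res n := (L0_mul (chi n)).
Hypothesis gq : forall n q, p < q -> ~ Lp mu q (res n g).

Let chiE n x : chi n x = (x \in E n)%:R.
Proof. exact: (congr1 (@^~ x) (mindicE R (mE n))). Qed.

Let chi_le1 n x : `|chi n x| <= 1.
Proof. by rewrite chiE; case: (_ \in _); rewrite ?normr1// normr0. Qed.

Let mfun_mulE (h1 h2 : {mfun T >-> R}) x : (h1 * h2) x = h1 x * h2 x.
Proof. by []. Qed.

Let res_res n m (f : L0 mu) : res n (res m f) = if n == m then res n f else 0.
Proof.
rewrite L0_mulA; case: eqVneq => [<-|nm].
  congr (L0_mul _ f); apply/mfuneqP => x.
  rewrite mfun_mulE !chiE.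
  by case: (_ \in _); rewrite ?mulr1 ?mulr0.
rewrite -[RHS](L0_mul0l f); congr (L0_mul _ f); apply/mfuneqP => x.
rewrite mfun_mulE !chiE; case: (boolP (x \in E n)) => xn; rewrite ?mul0r//.
case: (boolP (x \in E m)) => xm; rewrite ?mulr0//.
move: xn xm; rewrite !inE => xn xm.
by move/eqP: nm; case; apply: tE => //; exists x.
Qed.

(** The countably many exceptional null sets have a null union, and off it every point lies in some
    [E n]. *)
Let res_eq0 (f : L0 mu) : (forall n, res n f = 0) -> f = 0.
Proof.
move=> f0; apply/L0_eqP.
have : \forall x \ae mu, forall n, chi n x * f x = 0.
  apply: ae_foralln => n; have /L0_eqP := f0 n.
  have := L0_mulE (chi n) f; have := L0_0E mu.
  by apply: filterS3 => x /(_ I) /= -> /(_ I) /= -> /(_ I).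
have := L0_0E mu; apply: filterS2 => x + + _ => /(_ I) /= -> fx.
have [n _ xn] : (\bigcup_n E n) x by rewrite coverE.
by have := fx n; rewrite chiE mem_set// mul1r.
Qed.

(** The coefficients need no summability condition: it is implied by [u] being in L_p. *)
Let Y : set (LpType mu p0) :=
  [set u | forall n, exists c : R, res n (Lp_class u) = c *: res n g].

Let Y_submod_closed : submod_closed [in Y].
Proof.
split=> [|a u v]; first by rewrite inE => n; exists 0;
  rewrite Lp_class0 linear0 scale0r.
rewrite !inE => uY vY n; have [[b ub] [c vc]] := (uY n, vY n).
by exists (a * b + c);
  rewrite Lp_classD Lp_classZ linearP/= ub vc scalerA -scalerDl.
Qed.

Let Y_closed : closed Y.
Proof.
move=> u clu n; apply: (line_closed p0) => [|e e0].
  by apply/LpP; exact: Lp_mul.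
have [|v [Yv uv]] := clu (Lp_ball u e); first by exists e.
have [c vc] := Yv n; exists c; rewrite -vc -linearB -opprB linearN.
rewrite -scaleN1r LpNormZ// normrN1 mul1e.
by apply: le_lt_trans uv; exact: LpNorm_mul_le.
Qed.

Let Y_infinite_dimensional : ~ finite_dimensional Y.
Proof.
have gn n : Lp mu p (res n g) by exact: Lp_mul.
pose v n : LpType mu p0 := exist _ (res n g) (mem_set (gn n)).
apply: (@independent_not_finite_dimensional _ _ _ v) => [n m|m a va0 i].
  by exists (m == n)%:R; rewrite res_res; case: eqVneq => [->|_];
    rewrite ?scale1r ?scale0r.
have := congr1 (fun u => res i (Lp_class u)) va0.
rewrite (big_morph _ (@Lp_classD _ _ _ _ _ p0) (@Lp_class0 _ _ _ _ _ p0)).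
rewrite Lp_class0 linear0 linear_sum (bigD1 i)//= big1 => [|j ji].
  rewrite linearZ/= res_res eqxx addr0.
  (* A nonzero [a i] would force [res i g = 0], which lies in L_(p+1), against [gq]. *)
  apply: contra_eq => ai0; apply/eqP => /(congr1 (fun f => (a i)^-1 *: f)).
  rewrite scalerA mulVf// scale1r scaler0 => gi0.
  have pp1 : p < p + 1 by rewrite ltrDl.
  by apply: (gq pp1 (n := i)); rewrite gi0; apply/LpP;
     rewrite LpNorm0// (lt_trans p0).
by rewrite Lp_classZ linearZ/= res_res
  eq_sym (inj_eq val_inj) (negbTE ji) scaler0.
Qed.

Lemma spaceable_of_partition :
  spaceable [set u : LpType mu p0 |
    (Lp mu p `\` \bigcup_(q in [set q : R | p < q]) Lp mu q) (Lp_class u)].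
Proof.
exists Y; split => // u Yu; have [->|u0] := eqVneq u 0; [by right|left].
split; first exact: set_mem (valP u).
(* By contraposition: if [u] is in L_q, each coefficient [c] vanishes, since otherwise [res n g], a
   multiple of [res n u], would be in L_q too. Then all restrictions of [u] are zero. *)
move=> [q /= pq uq]; move/eqP: u0; apply; apply: val_inj => /=.
apply: res_eq0 => n; have [c uc] := Yu n.
have q0 := lt_trans p0 pq; have [c0|c0] := eqVneq c 0.
  by rewrite uc c0 scale0r.
case: (gq pq (n := n)); rewrite -(scale1r (res n g)) -(mulVf c0) -scalerA -uc.
by apply: LpZ => //; exact: Lp_mul.
Qed.

End spaceability_from_a_partition.

(** * Functions that factor through a map to the integers *)

Section step_functions.
Context d (T : measurableType d) (R : realType) (mu : {measure set T -> \bar R}).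
Variable (K : T -> nat).
Hypothesis mK : forall n, measurable (K @^-1` [set n]).

Lemma measurable_preimage_nat (B : set nat) : measurable (K @^-1` B).
Proof.
rewrite (_ : K @^-1` B = \bigcup_(n in B) (K @^-1` [set n])).
  by apply: bigcup_measurable => n _; exact: mK.
by apply/seteqP; split=> [x Bx|x [n Bn /= ->//]]; exists (K x).
Qed.

Lemma measurable_fun_nat_comp d' (T' : measurableType d') (v : nat -> T') :
  measurable_fun setT (v \o K).
Proof.
by move=> _ B mB; rewrite setTI comp_preimage; exact: measurable_preimage_nat.
Qed.

Lemma integral_nat_comp (v : nat -> \bar R) : (forall n, 0 <= v n)%E ->
  (\int[mu]_x v (K x) = \sum_(0 <= n <oo) v n * mu (K @^-1` [set n]))%E.
Proof.
move=> v0; rewrite (_ : setT = \bigcup_n (K @^-1` [set n])); last first.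
  by apply/seteqP; split=> // x _; exists (K x).
rewrite ge0_integral_bigcup//.
- apply: eq_eseriesr => n _; rewrite -integral_cst//.
  by apply: eq_integral => x; rewrite inE/= => ->.
- by apply: measurable_funTS; exact: measurable_fun_nat_comp.
- by move=> m n _ _ [x [/= <- <-]].
Qed.

(** Keeping a single fibre is enough later, because single levels already make the q-modular
    arbitrarily large. *)
Lemma integral_nat_comp_ge (v : nat -> \bar R) n : (forall n, 0 <= v n)%E ->
  (v n * mu (K @^-1` [set n]) <= \int[mu]_x v (K x))%E.
Proof.
move=> v0; rewrite -integral_cst//.
rewrite (eq_integral (fun x => v (K x))) => [|x]; last by rewrite inE/= => ->.
apply: ge0_subset_integral => //; exact: measurable_fun_nat_comp.
Qed.

End step_functions.

Lemma exists_logn2 (n N : nat) :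
  exists j, [/\ (N <= j)%N, (0 < j)%N & logn 2 j = n].
Proof.
(* The factor 2N + 1 is odd, so it leaves the valuation equal to n, and it exceeds N. *)
exists (2 ^ n * N.*2.+1)%N; split.
- by rewrite (leq_trans _ (leq_pmull _ _)) ?expn_gt0// -addnn leqW// leq_addr.
- by rewrite muln_gt0 expn_gt0.
- by rewrite lognM ?expn_gt0// pfactorK//
    logn_coprime ?addn0// coprime2n /= odd_double.
Qed.

(* [w ^ (q / p) * m] is the contribution of level j to the q-th modular of the
   step function, where [w = 2^-j / m] and [q / p = 1 + t]. *)
Lemma step_weight_ge (R : realType) (m t : R) (j : nat) :
  0 < m -> m <= (2 ^+ (j * j))^-1 -> 0 < t ->
  2 <= (j%:R - 1) * t -> (j%:R <= ((2 ^+ j)^-1 / m) `^ (1 + t) * m).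
Proof.
move=> m0 mj t0 jt; pose w := (2 ^+ j)^-1 / m.
have w0 : 0 < w by rewrite divr_gt0// invr_gt0 exprn_gt0.

have -> : (2 ^+ j)^-1 / m = w by [].
have powD1 : w `^ (1 + t) = w * w `^ t.
  rewrite powRD ?powRr1 ?(ltW w0)// (gt_eqF w0) implybT//.
rewrite powD1 mulrAC /w divfK ?gt_eqF// -/w.
(* The bound on [m] gives w >= 2^(j(j-1)), and (j-1)t >= 2 then gives w^t >= 2^(2j). The quantity to
   bound, 2^-j w^t, is thus at least 2^j >= j. *)
have wj : 2 `^ (j%:R * (j%:R - 1)) <= w.
  rewrite mulrBr mulr1 powRB ?pnatr_eq0 ?implybT//.
  rewrite -natrM !powR_mulrn// /w mulrC ler_pM2l ?invr_gt0 ?exprn_gt0//.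
  by rewrite -[leLHS]invrK lef_pV2 ?posrE ?invr_gt0 ?exprn_gt0.
have jw : 2 `^ (j%:R * 2) <= w `^ t.
  apply: le_trans (ge0_ler_powR (ltW t0) _ _ wj);
    rewrite ?nnegrE ?powR_ge0 ?(ltW w0)//.
  by rewrite -powRrM ler_powR ?ler1n// -mulrA ler_wpM2l.
rewrite ler_pdivlMl ?exprn_gt0//; apply: le_trans jw.
rewrite -(natrM _ j 2) powR_mulrn// muln2 -addnn exprD ler_pM2l ?exprn_gt0//.
by rewrite -natrX ler_nat ltnW// ltn_expl.
Qed.

(** * The step function on fibres of rapidly decreasing measure *)

Section spaceability_from_small_fibres.
Context d (T : measurableType d) (R : realType) (mu : {measure set T -> \bar R}).
Variables (p : R) (p0 : 0 < p) (K : T -> nat).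
Hypothesis mK : forall n, measurable (K @^-1` [set n]).
Hypothesis muK_gt0 : forall j, (0 < j)%N -> (0 < mu (K @^-1` [set j]))%E.
Hypothesis muK_le : forall j, (0 < j)%N ->
  (mu (K @^-1` [set j]) <= ((2 ^+ (j * j))^-1)%:E)%E.

Let m j := fine (mu (K @^-1` [set j])).

Let mE j : (0 < j)%N -> mu (K @^-1` [set j]) = (m j)%:E.
Proof.
move=> j0; rewrite fineK// ge0_fin_numE//.
exact: le_lt_trans (muK_le j0) (ltry _).
Qed.

Let m_gt0 j : (0 < j)%N -> 0 < m j.
Proof. by move=> j0; rewrite -lte_fin -mE// muK_gt0. Qed.

Let m_le j : (0 < j)%N -> m j <= (2 ^+ (j * j))^-1.
Proof. by move=> j0; rewrite -lee_fin -mE// muK_le. Qed.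

(* The level j > 0 carries the mass 2^-j of the p-th power of the function. *)
Let v j : R := if j is 0 then 0 else ((2 ^+ j)^-1 / m j) `^ p^-1.

Let v_ge0 j : 0 <= v j.
Proof. by case: j => //= j; exact: powR_ge0. Qed.

Let v_pow q j : (0 < j)%N -> v j `^ q = ((2 ^+ j)^-1 / m j) `^ (q / p).
Proof. by case: j => // j _; rewrite /v -powRrM [p^-1 * q]mulrC. Qed.

Let G : {mfun T >-> R} := mfun_Sub (mem_set (measurable_fun_nat_comp mK v)).

Let g : L0 mu := (\pi_(L0 mu) G)%qT.

Let g_Lp : Lp mu p g.
Proof.
apply/LpP_modular => //; rewrite (eq_LpModular p (L0_reprP mu G)).
rewrite (integral_nat_comp mu mK (v := fun j => (`|v j| `^ p)%:E)) =>
  [|j]; last first.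
  by rewrite lee_fin powR_ge0.
apply: (@le_lt_trans _ _ 2%:E); last exact: ltry.
(* The majorant has terms 2 / 2^(j+1) = 2^-j, the exact contribution of each level j > 0; level 0
   contributes nothing. *)
apply: le_trans (epsilon_trick0 xpredT _); last by [].
apply: lee_nneseries => [j _|j _].
  by rewrite mule_ge0// lee_fin powR_ge0.
case: j => [|j].
  by rewrite /= normr0 powR0 ?gt_eqF// mul0e lee_fin divr_ge0.
rewrite ger0_norm ?v_ge0// v_pow// divff ?gt_eqF// mE// -EFinM lee_fin.
rewrite powRr1 ?divfK ?gt_eqF ?m_gt0//; last first.
  by rewrite divr_ge0 ?invr_ge0 ?exprn_ge0// ltW// m_gt0.
by rewrite natrX (exprS _ j.+1) invfM mulrA divff ?mul1r ?pnatr_eq0.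
Qed.

Let E n := K @^-1` [set j | logn 2 j = n].

Let mEn n : measurable (E n).
Proof. exact: measurable_preimage_nat. Qed.

Let g_notLq n q : p < q ->
  ~ Lp mu q (L0_mul (mindic R (mEn n) : {mfun T >-> R}) g).
Proof.
move=> pq; have q0 := lt_trans p0 pq.
move=> /(LpP_modular _ q0); rewrite L0_mul_pi (eq_LpModular q (L0_reprP mu _)).
pose w j : \bar R := (`|(logn 2 j == n)%:R * v j| `^ q)%:E.
rewrite (eq_integral (fun x => w (K x))) => [|x _]; last first.
  rewrite /w; congr ((`|_ * _| `^ q)%:E).
  rewrite [LHS](congr1 (@^~ x) (mindicE R (mEn n))).
  by congr (_%:R); congr (nat_of_bool _); apply/idP/eqP; rewrite inE.
apply/negP; rewrite -leNgt leye_eq; apply/eqP/eqyP => A A0.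
pose t := q / p - 1.
have t0 : 0 < t by rewrite subr_gt0 ltr_pdivlMr// mul1r.
(* A level j of valuation n contributes at least j once (j-1)t >= 2. Taking j above A + 2/t + 1
   ensures this and also makes the contribution exceed A. *)
have [j [jA j0 jn]] := exists_logn2 n (Num.truncn (A + 2 / t + 1)).+1.
have {}jA : A + 2 / t + 1 < j%:R.
  by rewrite (lt_le_trans (truncnS_gt _))// ler_nat.
have t20 : 0 < 2 / t by rewrite divr_gt0.
have w_ge0 i : (0 <= w i)%E by rewrite lee_fin powR_ge0.
apply: le_trans (integral_nat_comp_ge mu mK j w_ge0).
rewrite /w jn eqxx mul1r ger0_norm// v_pow// mE// -EFinM lee_fin.
rewrite -[q / p](subrKC 1);
apply: le_trans (step_weight_ge (m_gt0 j0) (m_le j0) t0 _).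
  by rewrite ltW// (lt_trans _ jA)// -addrA ltrDl addr_gt0.
by rewrite -ler_pdivrMr// lerBrDr ltW// (lt_trans _ jA)// -addrA ltrDr.
Qed.

Lemma spaceable_of_small_fibres :
  spaceable [set u : LpType mu p0 |
    (Lp mu p `\` \bigcup_(q in [set q : R | p < q]) Lp mu q) (Lp_class u)].
Proof.
apply: (@spaceable_of_partition _ _ _ _ _ _ E mEn) g_Lp g_notLq.
- by move=> i j _ _ [x [/= <- <-]].
- by apply/seteqP; split=> // x _; exists (logn 2 (K x)).
Qed.

End spaceability_from_small_fibres.

(** * Thin intervals of [0, 1] as fibres *)

Lemma preimage_xget (T : Type) (A : nat -> set T) n : trivIset setT A ->
  (0 < n)%N -> (fun x => xget 0%N [set k | A k x]) @^-1` [set n] = A n.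
Proof.
move=> tA n0; apply/seteqP; split=> x /= => [xn|Anx].
  have [[k Akx]|nA] := pselect (exists k, A k x).
    by rewrite -xn; apply: (@xgetPex _ 0%N [set k | A k x]); exists k.
  (* A point in no [A k] gets the default index 0, excluded by [n0]. *)
  by move: n0; rewrite -xn xgetPN// => k Akx; apply: nA; exists k.
by apply: xget_unique => // k Akx; apply: tA => //; exists x.
Qed.

Lemma measurable_preimage_xget d (T : measurableType d) (A : nat -> set T) n :
  (forall k, measurable (A k)) -> trivIset setT A ->
  measurable ((fun x => xget 0%N [set k | A k x]) @^-1` [set n]).
Proof.
move=> mA tA; case: n => [|n]; last by rewrite preimage_xget.
pose K x := xget 0%N [set k | A k x].
(* The fibre over 0 mixes [A 0] with the points outside every [A k]; it is the complement of the
   other fibres. *)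
rewrite (_ : _ @^-1` _ = ~` \bigcup_n K @^-1` [set n.+1]).
  by apply: measurableC; apply: bigcup_measurable => n _; rewrite preimage_xget.
apply/seteqP; split=> x /= => [K0 [n _ /=]|KN]; first by rewrite /K K0.
by case Kx: (xget _ _) => [//|n]; case: KN; exists n.
Qed.

(** The length is 2^-(k^2+1), within the required bound 2^-(k^2). Intervals of indices i < j are
    disjoint because i^2 + 1 <= j^2. *)
Definition thin_itv (R : realType) k : set R :=
  `](2 ^+ (k * k).+1)^-1, (2 ^+ (k * k))^-1].

Lemma trivIset_thin_itv (R : realType) : trivIset setT (@thin_itv R).
Proof.
apply: ltn_trivIset => i j ij; apply/seteqP; split=> // x [].
rewrite /thin_itv /= !in_itv/= => /andP[xi _] /andP[_ xj].
have := lt_le_trans xi xj; rewrite ltf_pV2 ?posrE ?exprn_gt0//.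
by rewrite ltr_eXn2l ?ltr1n// ltnS leqNgt ltn_mul.
Qed.

Lemma measurable_thin_itv (R : realType) k :
  measurable (thin_itv k : set (caratheodory_type (wlength (@idfun R))^*%mu)).
Proof. by apply: sub_caratheodory; exact: measurable_itv. Qed.

Lemma lebesgue01_thin_itv (R : realType) k :
  lebesgue01 (thin_itv k) = ((2 ^+ (k * k).+1)^-1)%:E :> \bar R.
Proof.
(* Restriction of the measure is intersection with [0, 1], and the completed and Borel measures
   agree by conversion. *)
have -> : lebesgue01 (@thin_itv R k) =
    lebesgue_measure (@thin_itv R k `&` `[0, 1]) by [].
have e0 n : 0 < (2 ^+ n)^-1 :> R by rewrite invr_gt0 exprn_gt0.
rewrite setIidl; last first.
  move=> x; rewrite /thin_itv /= !in_itv/= => /andP[xi xj].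
  rewrite (le_trans _ (ltW xi)) ?(ltW (e0 _))//= (le_trans xj)//
    invf_le1 ?exprn_gt0//.
  by rewrite exprn_ege1// ler1n.
rewrite lebesgue_measure_itv/= lte_fin ltf_pV2 ?posrE ?exprn_gt0//.
rewrite ltr_eXn2l ?ltr1n// ltnSn -EFinB exprS invfM; congr (_%:E).
by rewrite -[X in X - _]mul1r -mulrBl [X in X - _]splitr div1r addrK.
Qed.

Theorem mainTheorem1 (R : realType) (p : R) (p0 : 0 < p) :
  spaceable [set u : LpType lebesgue01 p0 |
    (Lp lebesgue01 p `\` \bigcup_(q in [set q : R | p < q]) Lp lebesgue01 q)
      (Lp_class u)].
Proof.
have mA := @measurable_thin_itv R; have tA := @trivIset_thin_itv R.
apply: (spaceable_of_small_fibres p0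
  (fun n => measurable_preimage_xget n mA tA)) => j j0.
  by rewrite preimage_xget// [X in (_ < X)%E]lebesgue01_thin_itv
    lte_fin invr_gt0 exprn_gt0.
rewrite preimage_xget// [X in (X <= _)%E]lebesgue01_thin_itv
  lee_fin lef_pV2 ?posrE ?exprn_gt0//.
by rewrite ler_eXn2l ?ltr1n.
Qed.
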